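(* Let $R\ge 0$ and suppose there is a primitive polynomial $c(x)=\sum_{i=0}^n c_ix^i$ of degree $n$ over $\mathrm{GF}(2)$ with $c_0=c_n=1$ and $c_i=0$ for $1\le i\le 2R+1$. Let $\mathcal{A}$ be the cyclic sequence of length $2^n-1$ generated by $a_k=\sum_{i=1}^n c_ia_{k-i}$ (mod 2) from a nonzero initial $n$-tuple, and $\mathcal{B}$ the cyclic sequence of length $2^n-1$ generated by $b_k=\sum_{i=1}^n c_ib_{k-i}+1$ (mod 2) from an initial $n$-tuple different from all-ones. Then the four sequences $\mathcal{A}$, $\mathcal{B}$, $[0]$, $[1]$ can be combined into a single binary $(n+2R+1,R)$-covering sequence of length $2^{n+1}+2n+8R+2$; in particular such a covering sequence exists.
   Context: A cyclic binary sequence $[s_0,\ldots,s_{k-1}]$ of length $k$ has as its windows of length $N$ the words $(s_i,\ldots,s_{i+N-1})$, $0\le i\le k-1$, indices modulo $k$. It is an $(N,R)$-covering sequence if for every $x\in\{0,1\}^N$ some window $w$ satisfies Hamming distance $d(x,w)\le R$. A polynomial over $\mathrm{GF}(2)$ of degree $n$ is primitive if it is irreducible and its roots have multiplicative order $2^n-1$. *)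

(* Defs.v *)
(* Mathematical Components world. *)
From HB Require Import structures.
From mathcomp Require Import all_boot all_order all_algebra all_field.

Set Implicit Arguments.
Unset Strict Implicit.
Unset Printing Implicit Defensive.

Import GRing.Theory.
Local Open Scope ring_scope.

(* The library defines primitive_poly c by the multiplicative order of 'X modulo
   c; over GF(2) this is the definition by the order of the roots of c. *)
Lemma primitive_poly_roots (n : nat) (c : {poly 'F_2}) : size c = n.+1 ->
  primitive_poly c <->
  irreducible_poly c /\
  (forall (L : fieldExtType 'F_2) (z : L),
     root (map_poly (in_alg L) c) z -> (2 ^ n - 1)%N.-primitive_root z).
Proof.
move=> sc.
have F2 (x : 'F_2) : x != 0 -> x = 1.
  by case: x => [[|[|m]] i] // _; apply: val_inj.
have c0 : c != 0 by rewrite -size_poly_gt0 sc.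
have cm : c \is monic by apply/eqP/F2; rewrite lead_coef_eq0.
have cardc : irreducible_poly c -> #|{poly %/ c}|.-1 = (2 ^ n - 1)%N.
  move=> [c1 _].
  by rewrite card_monic_qpoly // sc card_Fp //= subn1.
have dvdz (L : fieldExtType 'F_2) (z : L) m : irreducible_poly c ->
    root (map_poly (in_alg L) c) z -> (c %| 'X^m - 1) = (z ^+ m == 1).
  move=> [c1 ci] rz.
  have rX : root (map_poly (in_alg L) ('X^m - 1)) z = (z ^+ m == 1).
    by rewrite rmorphB /= map_polyXn rmorph1 /root !hornerE subr_eq0.
  rewrite -rX; apply/idP/idP => [/dvdpP[q ->]|rm].
    by rewrite rmorphM /= rootM rz orbT.
  have := dvdp_gcdl c ('X^m - 1) => gc.
  have [g1|gn1] := eqVneq (size (gcdp c ('X^m - 1))) 1%N; last first.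
    by rewrite -(eqp_dvdl _ (ci _ gn1 gc)) dvdp_gcdr.
  have : root (gcdp (map_poly (in_alg L) c)
                (map_poly (in_alg L) ('X^m - 1))) z by rewrite root_gcd rz rm.
  rewrite -gcdp_map => /root_size_gt1.
  by rewrite size_map_poly map_poly_eq0 gcdp_eq0 (negPf c0) g1 => /(_ isT).
split.
- move/primitive_polyP => /= [[ci _] cX cmin]; split=> // L z rz.
  have n0 : (0 < n)%N by case: ci; rewrite sc ltnS.
  have v0 : (0 < 2 ^ n - 1)%N by rewrite subn_gt0 -{1}(expn0 2) ltn_exp2l.
  rewrite cardc // in cX cmin.
  rewrite /primitive_root_of_unity v0 /=; apply/forallP => i; apply/eqP.
  rewrite unity_rootE -dvdz //.
  have [->|ne] := eqVneq i.+1 (2 ^ n - 1)%N; first by rewrite cX.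
  by apply/negbTE/cmin; rewrite /= ltn_neqAle ne ltn_ord.
- move=> [ci cr]; apply/primitive_polyP => /=; rewrite cardc //.
  have [L _ [z rz _]] := irredp_FAdjoin ci.
  have pz := cr L z rz.
  split=> //; first by rewrite (dvdz L z) // (prim_expr_order pz).
  move=> m /andP[m0 mv]; rewrite (dvdz L z) // -(prim_order_dvd pz).
  by rewrite gtnNdvd.
Qed.

(* The recurrence s_k = c_1 s_{k-1} + ... + c_n s_{k-n} + e, for k >= n; the
   terms s_0, ..., s_{n-1} form the initial n-tuple. *)
Definition recurrence (n : nat) (c : {poly 'F_2}) (e : 'F_2)
    (s : nat -> 'F_2) : Prop :=
  forall k : nat, (n <= k)%N ->
    s k = \sum_(1 <= i < n.+1) c`_i * s (k - i)%N + e.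

(* A cyclic sequence is represented by the list of its symbols.  The index is
   reduced modulo size s, so m may exceed size s. *)
Definition cyclic_factor (s : seq 'F_2) (i m : nat) : seq 'F_2 :=
  mkseq (fun j => s`_((i + j) %% size s)) m.

Definition hamming (x y : seq 'F_2) (N : nat) : nat :=
  #|[set j : 'I_N | x`_j != y`_j]|.

Definition covering_sequence (N R : nat) (s : seq 'F_2) : Prop :=
  forall x : N.-tuple 'F_2,
    exists2 i : nat, (i < size s)%N & (hamming x (cyclic_factor s i N) N <= R)%N.

(* The cyclic sequence t, opened at some position, has the linear word of
   length size t + N - 1 that contains each of its windows of length N exactly
   once, in order; this word is read in s starting at position p. *)
Definition opened_at (N : nat) (s t : seq 'F_2) (p : nat) : Prop :=
  exists2 q : nat, (q < size t)%N &
    cyclic_factor s p (size t + N - 1) = cyclic_factor t q (size t + N - 1).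

(* s is obtained by opening the cyclic sequences in ts and gluing the resulting
   linear words cyclically, possibly with overlaps: each of these words occurs
   in s, and every position of s belongs to one of the occurrences. *)
Definition combines (N : nat) (ts : seq (seq 'F_2)) (s : seq 'F_2) : Prop :=
  exists p : nat -> nat,
    (forall l : nat, (l < size ts)%N ->
       (p l < size s)%N /\ opened_at N s (nth [::] ts l) (p l)) /\
    (forall i : nat, (i < size s)%N ->
       exists l d : nat,
         [/\ (l < size ts)%N, (d < size (nth [::] ts l) + N - 1)%N &
             i = ((p l + d) %% size s)%N]).

(* Main.v *)
(* The words of length n + 2R + 1 satisfying the recurrence with constant e are
   the windows of A and [0] when e = 0, of B and [1] when e = 1.  Because
   c_1 = ... = c_(2R+1) = 0, both extensions of a given n-tuple to such a word
   depend only on that n-tuple, and they differ in all of the last 2R + 1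
   symbols.  A word x with the same first n symbols hence disagrees with them
   in at most 2R + 1 places altogether, so with one of them in at most R.

   For the length, open A at a run of n - 1 zeros and B at a run of n - 1 ones,
   and overlap these runs with the words of [0] and [1]. *)
Require Import Defs.
From HB Require Import structures.
From mathcomp Require Import all_boot all_order all_algebra all_field zify.

Set Implicit Arguments.
Unset Strict Implicit.
Unset Printing Implicit Defensive.

Import GRing.Theory.
Local Open Scope ring_scope.

(** * Arithmetic over GF(2) and coefficients of products *)

Lemma F2_addrr (x : 'F_2) : x + x = 0.
Proof. by apply: addrr_pchar2; apply: pchar_Fp. Qed.

Lemma F2_addr_eq0 (x y : 'F_2) : (x + y == 0) = (x == y).
Proof. by rewrite addr_eq0 oppr_pchar2 // pchar_Fp. Qed.

Lemma F2_neq0 (x : 'F_2) : x != 0 -> x = 1.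
Proof. by case: x => [[|[|m]] i] // _; apply: val_inj. Qed.

Lemma F2_neq (x y : 'F_2) : x != y -> x = y + 1.
Proof.
rewrite -subr_eq0 => /F2_neq0 /eqP.
by rewrite subr_eq addrC => /eqP.
Qed.

(** Coefficient [k] of [q * p] only involves the coefficients of [p] at the last [size q] indices up
    to [k]. Here [m] will be the point where a generating series is truncated. *)
Lemma coefM_vanish (A : nzRingType) (q p : {poly A}) (K m : nat) :
  (forall k, (K <= k < m)%N -> p`_k = 0) ->
  forall k, (K + size q <= k.+1)%N -> (k < m)%N -> (q * p)`_k = 0.
Proof.
move=> p0 k Kk km; rewrite coefM big1 // => j _.
have [jq|qj] := ltnP j (size q); last by rewrite nth_default ?mul0r.
rewrite p0 ?mulr0 //; apply/andP; split; lia.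
Qed.

(** * Linear recurrences and their truncated generating series *)

Section Recurrence.

Variables (n : nat) (c : {poly 'F_2}).

Lemma recurrence_shift e s d :
  recurrence n c e s -> recurrence n c e (fun k => s (d + k)%N).
Proof.
move=> rs k nk; rewrite rs; last by lia.
by congr (_ + _); apply: eq_big_nat => i /andP[_ i_n]; rewrite addnBA //; lia.
Qed.

Lemma recurrence_inj e s t :
  recurrence n c e s -> recurrence n c e t ->
  (forall j, (j < n)%N -> s j = t j) -> s =1 t.
Proof.
move=> rs rt st; elim/ltn_ind => k IH.
have [/st//|nk] := ltnP k n.
rewrite rs // rt //; congr (_ + _); apply: eq_big_nat => i /andP[i0 i_n].
by rewrite IH //; lia.
Qed.

Lemma recurrenceD e e' s t :
  recurrence n c e s -> recurrence n c e' t ->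
  recurrence n c (e + e') (fun k => s k + t k).
Proof.
move=> rs rt k nk; rewrite rs // rt // addrACA -big_split /=.
by congr (_ + _); apply: eq_bigr => i _; rewrite mulrDr.
Qed.

Lemma recurrence_exists e (x : nat -> 'F_2) :
  exists2 s, recurrence n c e s & forall j, (j < n)%N -> s j = x j.
Proof.
(* [f k] lists the terms of index k - 1 down to 0, which makes the recursion structural; the term of
   index k' - i sits at place i - 1 of [f k']. *)
pose f := fix f k : seq 'F_2 := if k is k'.+1 then
    (if (k' < n)%N then x k' else
       \sum_(1 <= i < n.+1) c`_i * (f k')`_(i.-1) + e) :: f k'
  else [::].
have fE k j : (j < k)%N -> (f k)`_j = head 0 (f (k - j)%N).
  by elim: k j => // k IH [|j] //= jk; rewrite IH // subSS.
exists (fun k => head 0 (f k.+1)) => [k nk|j jn]; last by rewrite /= jn.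
rewrite /= ltnNge nk /=; congr (_ + _).
apply: eq_big_nat => i /andP[i0 i_n].
rewrite fE; last by lia.
by rewrite (_ : (k - i.-1 = (k - i).+1)%N) //; lia.
Qed.

Hypotheses (sc : size c = n.+1) (c0 : c`_0 = 1).

(** As c_0 = 1, this coefficient is a_k plus the right side of the recurrence, hence twice the same
    element of GF(2). Below [n] the initial tuple interferes, from [m] on the truncation. *)
Lemma recurrence_coef a m k : recurrence n c 0 a -> (n <= k < m)%N ->
  (c * \poly_(i < m) a i)`_k = 0.
Proof.
move=> ra /andP[nk km]; rewrite coefM.
rewrite -(big_mkord xpredT (fun j => c`_j * (\poly_(i < m) a i)`_(k - j))).
rewrite (big_cat_nat (n := n.+1)) //= [X in _ + X]big_nat_cond.
rewrite [X in _ + X]big1 ?addr0; last first.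
  by move=> i /andP[/andP[ni _] _]; rewrite [c`_i]nth_default ?mul0r // sc.
rewrite big_ltn // c0 mul1r subn0 coef_poly km ra // addr0.
rewrite -[RHS](F2_addrr (\sum_(1 <= i < n.+1) c`_i * a (k - i)%N)).
congr (_ + _); apply: eq_big_nat => i /andP[i0 i_n].
by rewrite coef_poly (leq_ltn_trans _ km) ?leq_subr.
Qed.

(** Every multiple of [c] annihilates the sequence too, from the index deg p on. *)
Lemma dvdp_recurrence_coef a m p k : recurrence n c 0 a -> c %| p ->
  (size p <= k.+1)%N -> (k < m)%N -> (p * \poly_(i < m) a i)`_k = 0.
Proof.
move=> ra /dvdpP[q ->] spk km.
have c_neq0 : c != 0 by rewrite -size_poly_eq0 sc.
have [->|q0] := eqVneq q 0; first by rewrite !mul0r coef0.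
rewrite -mulrA; apply: (coefM_vanish (K := n) (m := m)) => // [j|].
  exact: recurrence_coef.
by move: spk; rewrite size_mul // sc addnS /= addnC.
Qed.

(** * Period and windows of homogeneous solutions for primitive [c] *)

Hypothesis (prim : primitive_poly c).

Lemma primitive_dvdp :
  c %| 'X^(2 ^ n - 1) - 1 /\
  forall d, (0 < d < 2 ^ n - 1)%N -> ~~ (c %| 'X^d - 1).
Proof.
have /primitive_polyP[[[c1 _] cm]] /= := prim.
by rewrite card_monic_qpoly // sc card_Fp //= -subn1.
Qed.

Lemma primitive_irreducible : irreducible_poly c.
Proof. by have /primitive_polyP[[]] := prim. Qed.

Lemma primitive_deg_gt0 : (0 < n)%N.
Proof. by have [] := primitive_irreducible; rewrite sc ltnS. Qed.

Lemma primitive_period_gt0 : (0 < 2 ^ n - 1)%N.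
Proof. by rewrite subn_gt0 -{1}(expn0 2) ltn_exp2l ?primitive_deg_gt0. Qed.

Lemma coef_XnsubCM a d m k : (d + k < m)%N ->
  (('X^d - 1) * \poly_(i < m) a i : {poly 'F_2})`_(d + k) = a k - a (d + k)%N.
Proof.
move=> km; rewrite mulrBl mul1r coefB coefXnM !coef_poly km.
by rewrite ltnNge leq_addr /= addnC addnK; case: ltnP => //; lia.
Qed.

(** X^(2^n - 1) - 1 is a multiple of [c], so it annihilates [a]. *)
Lemma recurrence0_period a k :
  recurrence n c 0 a -> a (2 ^ n - 1 + k)%N = a k.
Proof.
move=> ra; have [cX _] := primitive_dvdp.
have := @dvdp_recurrence_coef a (2 ^ n - 1 + k).+1 _ (2 ^ n - 1 + k)%N ra cX.
rewrite coef_XnsubCM // size_XnsubC ?primitive_period_gt0 // => H.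
by apply/esym/eqP; rewrite -subr_eq0 H //; lia.
Qed.

Lemma recurrence0_eventually0 a K : recurrence n c 0 a ->
  (forall k, (K <= k)%N -> a k = 0) -> a =1 fun=> 0.
Proof.
move=> ra a0 k.
have per i : a ((2 ^ n - 1) * i + k)%N = a k.
  elim: i => [|i IH]; first by rewrite muln0.
  by rewrite mulnS -addnA recurrence0_period.
rewrite -(per K) a0 //; have := primitive_period_gt0; nia.
Qed.

(** A zero window forces zeros from there on, and periodicity carries them back to the start. *)
Lemma recurrence0_window_neq0 a k : recurrence n c 0 a ->
  (exists2 i, (i < n)%N & a i != 0) ->
  exists2 j, (j < n)%N & a (k + j)%N != 0.
Proof.
move=> ra [i i_n ai].
have [/existsP[j aj]|/existsPn H] := boolP [exists j : 'I_n, a (k + j)%N != 0].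
  by exists j.
suff a0 : a =1 fun=> 0 by rewrite a0 eqxx in ai.
have rz : recurrence n c 0 (fun=> 0).
  by move=> j _; rewrite addr0 big1 // => l _; rewrite mulr0.
apply: (recurrence0_eventually0 (K := k) ra) => j kj.
have /(_ (j - k)%N) : (fun j => a (k + j)%N) =1 fun=> 0.
  apply: (recurrence_inj (recurrence_shift k ra) rz).
  by move=> l ln; have /= := H (Ordinal ln); rewrite negbK => /eqP.
by rewrite subnKC.
Qed.

(* If two windows at distance d agree, then a is annihilated both by c and by
   X^d - 1, which are coprime when d is smaller than the order of X modulo c. *)
Lemma recurrence0_window_inj a k d : recurrence n c 0 a ->
  (exists2 i, (i < n)%N & a i != 0) -> (0 < d < 2 ^ n - 1)%N ->
  ~ (forall j, (j < n)%N -> a (k + j)%N = a (d + k + j)%N).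
Proof.
move=> ra [i i_n ai] dv H.
have {}H : forall j, a (k + j)%N = a (d + k + j)%N.
  have shift := recurrence_shift _ ra.
  by apply: (recurrence_inj (shift k) (shift (d + k)%N)) H.
have [_ /(_ d dv)] := primitive_dvdp.
rewrite -(irreducible_poly_coprime _ primitive_irreducible).
move=> /Bezout_eq1_coprimepP[[u w] /= uw].
suff a0 : a =1 fun=> 0 by rewrite a0 eqxx in ai.
(* This bound lies beyond the points from which the coefficients of both Bezout summands vanish;
   truncating at [j.+1] keeps the term a_j. *)
apply: (recurrence0_eventually0 (K := d + k + n + size u + size w)%N ra) => j Kj.
set m := j.+1; pose A := \poly_(i < m) a i.
have <- : A`_j = a j by rewrite coef_poly ltnSn.
rewrite -[A]mul1r -uw mulrDl coefD -!mulrA.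
rewrite (coefM_vanish (K := n) (m := m)) ?add0r //; first last.
- by move: Kj; set su := size u; lia.
- by move=> l; apply: recurrence_coef.
apply: (coefM_vanish (K := (d + k)%N) (m := m)) => //; last first.
  by move: Kj; set sw := size w; lia.
move=> l /andP[dkl lm].
have -> : l = (d + (k + (l - (d + k))))%N by lia.
rewrite coef_XnsubCM; last by lia.
by rewrite H addnA subrr.
Qed.

(* The 2^n - 1 windows are distinct and nonzero, so they exhaust the nonzero
   n-tuples. *)
Lemma recurrence0_window_onto a (x : nat -> 'F_2) : recurrence n c 0 a ->
  (exists2 i, (i < n)%N & a i != 0) -> (exists2 i, (i < n)%N & x i != 0) ->
  exists2 k, (k < 2 ^ n - 1)%N & forall j, (j < n)%N -> a (k + j)%N = x j.
Proof.
move=> ra a0 [i i_n xi].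
pose w (k : 'I_(2 ^ n - 1)) : {ffun 'I_n -> 'F_2} := [ffun j => a (k + val j)%N].
have wE (k l : 'I_(2 ^ n - 1)) j : w k = w l -> (j < n)%N ->
    a (k + j)%N = a (l + j)%N.
  by move=> + jn => /ffunP/(_ (Ordinal jn)); rewrite !ffunE.
have w_inj : injective w.
  have ltP (k l : 'I_(2 ^ n - 1)) : (k < l)%N -> w k <> w l.
    move=> kl wkl; apply: (@recurrence0_window_inj a k (l - k) ra a0).
      by have := ltn_ord l; lia.
    by move=> j jn; rewrite subnK 1?ltnW // (wE k l).
  by move=> k l wkl; apply: val_inj; case: (ltngtP k l) => // /ltP; rewrite wkl.
pose z : {ffun 'I_n -> 'F_2} := [ffun=> 0].
have wz k : w k \in [set~ z].
  rewrite !inE; have [j jn aj] := @recurrence0_window_neq0 a k ra a0.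
  by apply: contra aj => /eqP/ffunP/(_ (Ordinal jn)); rewrite !ffunE => ->.
have img : w @: [set: 'I_(2 ^ n - 1)] = [set~ z].
  apply/eqP; rewrite eqEcard; apply/andP; split.
    by apply/subsetP => _ /imsetP[k _ ->].
  by rewrite card_imset // cardsT cardsC1 card_ffun !card_ord subn1.
have : [ffun j : 'I_n => x j] \in [set~ z].
  rewrite !inE; apply: contra xi => /eqP/ffunP/(_ (Ordinal i_n)).
  by rewrite !ffunE => /= ->.
rewrite -img => /imsetP[k _ xk]; exists k => // j jn.
by move/ffunP: xk => /(_ (Ordinal jn)); rewrite !ffunE.
Qed.

(** * Reduction of the recurrence with constant [e] to the homogeneous one *)

Hypothesis n_gt1 : (1 < n)%N.

(** An irreducible [c] of degree above 1 has no root 1, so c(1) = 1 = c_0. This makes the constant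
    sequence [e] a solution for the constant [e]. *)
Lemma sum_coef_eq0 : \sum_(1 <= i < n.+1) c`_i = 0.
Proof.
have /F2_neq0 : c.[1] != 0.
  apply/negP; rewrite -/(root c 1) -dvdp_XsubCl => X1c.
  have [_ /(_ ('X - 1%:P))] := primitive_irreducible.
  by rewrite size_XsubC => /(_ isT X1c)/eqp_size; rewrite size_XsubC sc; lia.
rewrite horner_coef sc; under eq_bigr do rewrite expr1n mulr1.
rewrite -(big_mkord xpredT (fun i => c`_i)) big_ltn // c0.
by move=> /(canRL (addKr _)) ->; rewrite addrC subrr.
Qed.

Lemma recurrence_const e : recurrence n c e (fun=> e).
Proof. by move=> k nk; rewrite -mulr_suml sum_coef_eq0 mul0r add0r. Qed.

Lemma recurrence_center e s : recurrence n c e s ->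
  recurrence n c 0 (fun k => s k + e).
Proof.
by move=> rs; rewrite -(F2_addrr e); apply: recurrenceD; last exact: recurrence_const.
Qed.

Lemma recurrence_period e s k : recurrence n c e s ->
  s (2 ^ n - 1 + k)%N = s k.
Proof.
by move=> /recurrence_center /(@recurrence0_period _ k) /addIr.
Qed.

Lemma recurrence_window_onto e s (x : nat -> 'F_2) : recurrence n c e s ->
  (exists2 i, (i < n)%N & s i != e) -> (exists2 i, (i < n)%N & x i != e) ->
  exists2 k, (k < 2 ^ n - 1)%N & forall j, (j < n)%N -> s (k + j)%N = x j.
Proof.
move=> /recurrence_center rs [i i_n si] [i' i'n xi].
have [||k kv kP] := @recurrence0_window_onto _ (fun j => x j + e) rs.
- by exists i; rewrite // F2_addr_eq0.
- by exists i'; rewrite // F2_addr_eq0.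
by exists k => // j /kP /addIr.
Qed.

End Recurrence.

(** * Windows of cyclic sequences and of their gluings *)

Lemma cyclic_factor_cat (s1 s2 s3 : seq 'F_2) :
  cyclic_factor (s1 ++ s2 ++ s3) (size s1) (size s2) = s2.
Proof.
apply: (@eq_from_nth _ 0); rewrite size_mkseq // => j js.
rewrite nth_mkseq // modn_small ?size_cat; last by lia.
by rewrite nth_cat ltnNge leq_addr /= addKn nth_cat js.
Qed.

Lemma cyclic_factor_mkseq (a : nat -> 'F_2) v q m : (0 < v)%N ->
  (forall k, a (v + k)%N = a k) ->
  cyclic_factor (mkseq a v) q m = mkseq (fun j => a (q + j)%N) m.
Proof.
move=> v0 per.
have aE k : a (k %% v)%N = a k.
  rewrite [in RHS](divn_eq k v); elim: (k %/ v)%N => // i ->.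
  by rewrite mulSn -addnA per.
by apply: eq_mkseq => j; rewrite size_mkseq nth_mkseq ?ltn_pmod.
Qed.

Lemma cyclic_factor1 (e : 'F_2) q m : cyclic_factor [:: e] q m = nseq m e.
Proof.
apply: (@eq_from_nth _ 0); rewrite size_mkseq ?size_nseq // => j jm.
by rewrite nth_mkseq // modn1 nth_nseq jm.
Qed.

Lemma opened_at_cat N (s t s1 s2 s3 : seq 'F_2) q : (0 < N)%N ->
  s = s1 ++ s2 ++ s3 -> (q < size t)%N ->
  s2 = cyclic_factor t q (size t + N - 1) ->
  (size s1 < size s)%N /\ opened_at N s t (size s1).
Proof.
move=> N0 -> qt s2E.
have s2s : size s2 = (size t + N - 1)%N by rewrite s2E size_mkseq.
split; first by rewrite !size_cat; lia.
by exists q => //; rewrite -s2E -s2s cyclic_factor_cat.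
Qed.

Lemma combines_window N ts s l k : combines N ts s -> (l < size ts)%N ->
  (k < size (nth [::] ts l))%N ->
  exists2 i, (i < size s)%N &
    cyclic_factor s i N = cyclic_factor (nth [::] ts l) k N.
Proof.
move=> [p [open _]] lts; set t := nth _ _ _ => kt.
have [ps [q qt st]] := open l lts; rewrite -/t in qt st.
(* The distance from the opening point [q] forward to [k] around the cycle; being below [size t], it
   leaves room for a full window inside the opened word. *)
pose d := ((k + (size t - q)) %% size t)%N.
have dt : (d < size t)%N by rewrite ltn_pmod //; lia.
exists ((p l + d) %% size s)%N; first by rewrite ltn_pmod //; lia.
apply: (@eq_from_nth _ 0); rewrite !size_mkseq // => j jN.
have := congr1 (fun u : seq 'F_2 => u`_(d + j)) st.
rewrite !nth_mkseq ?modnDml -?addnA //; [|by lia..].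
move=> ->; congr (_`_ _); rewrite addnCA modnDml.
by rewrite (_ : (k + (_ - q) + _ = k + j + size t)%N) ?modnDr //; lia.
Qed.

(** * The two complementary extensions of an n-tuple *)

Lemma hamming_complementary (n R : nat) (c : {poly 'F_2})
    (w : 'F_2 -> nat -> 'F_2) (x : seq 'F_2) :
  (forall i, (1 <= i <= 2 * R + 1)%N -> c`_i = 0) ->
  (forall e, recurrence n c e (w e)) ->
  (forall e j, (j < n)%N -> w e j = x`_j) ->
  exists e, (hamming x (mkseq (w e) (n + 2 * R + 1)) (n + 2 * R + 1) <= R)%N.
Proof.
move=> gap rw wx; set N := (n + 2 * R + 1)%N.
pose D e := [set j : 'I_N | x`_j != (mkseq (w e) N)`_j].
have DE e (j : 'I_N) : (j \in D e) = (x`_j != w e j) by rewrite inE nth_mkseq.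
(* The surviving coefficients have i >= 2R + 2, so j - i < n and both words read the common initial
   tuple. *)
have w01 j : (n <= j < N)%N -> w 1 j = w 0 j + 1.
  move=> /andP[nj jN]; rewrite !rw // addr0; congr (_ + _).
  apply: eq_big_nat => i /andP[i0 i_n].
  have [iR|Ri] := leqP i (2 * R + 1); first by rewrite gap ?i0 // !mul0r.
  by rewrite !wx //; lia.
have Dn e j : j \in D e -> (n <= j)%N.
  by rewrite DE leqNgt; apply: contra => /(wx e) ->.
have dis : D 0 :&: D 1 = set0.
  apply/setP => j; rewrite inE in_set0; apply/negP => /andP[D0 D1].
  have nj : (n <= j < N)%N by rewrite (Dn _ _ D0) ltn_ord.
  move: D0 D1; rewrite !DE => /F2_neq xj.
  by rewrite w01 // xj eqxx.
(* Shifting by [n] embeds the disagreements into the 2R + 1 last places; the sets being disjoint,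
   one has at most R elements. *)
have DU : (#|D 0%R :|: D 1%R| <= (2 * R).+1)%N.
  pose f (j : 'I_N) : 'I_(2 * R).+1 := inord (j - n).
  have nU j : j \in D 0 :|: D 1 -> (n <= j)%N by rewrite inE => /orP[]; apply: Dn.
  have f_inj : {in D 0 :|: D 1 &, injective f}.
    move=> i j /nU ni /nU nj /(congr1 val) /=.
    have iN : (i < n + 2 * R + 1)%N := ltn_ord i.
    have jN : (j < n + 2 * R + 1)%N := ltn_ord j.
    rewrite !inordK; try lia; move=> ij; apply: val_inj => /=; lia.
  rewrite -(card_in_imset f_inj) (leq_trans (max_card _)) //.
  by rewrite card_ord.
rewrite cardsU dis cards0 subn0 in DU.
have [D0|D0] := leqP #|D 0| R; first by exists 0.
exists 1; rewrite /hamming -/(D 1).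
move: D0 DU; set d0 := #|D 0|; set d1 := #|D 1|; lia.
Qed.

(** * Gluing the four sequences *)

Lemma mkseq_nseq_cat (T : Type) (f : nat -> T) e k m :
  (forall j, (j < k)%N -> f j = e) ->
  mkseq f (k + m) = nseq k e ++ mkseq (fun j => f (k + j)%N) m.
Proof.
move=> fe; apply: (@eq_from_nth _ e).
  by rewrite size_cat size_nseq !size_mkseq.
rewrite size_mkseq => j jkm; rewrite nth_mkseq // nth_cat size_nseq nth_nseq.
case: ltnP => jk; first exact: fe.
by rewrite nth_mkseq ?subnKC //; lia.
Qed.

(** The n-tuple made of n - 1 symbols [e] followed by e + 1 is not constantly [e], hence occurs as a
    window. *)
Lemma recurrence_run n (c : {poly 'F_2}) e s : size c = n.+1 -> c`_0 = 1 ->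
  primitive_poly c -> (1 < n)%N ->
  recurrence n c e s -> (exists2 i, (i < n)%N & s i != e) ->
  exists2 q, (q < 2 ^ n - 1)%N &
    forall j, (j < n.-1)%N -> s (q + j)%N = e.
Proof.
move=> sc c0 prim n1 rs s0.
pose x j := if (j < n.-1)%N then e else e + 1.
have [|q qv qx] := recurrence_window_onto sc c0 prim n1 (x := x) rs s0.
  exists n.-1; first by lia.
  by rewrite /x ltnn -subr_eq0 addrC addKr oner_eq0.
by exists q => // j jn; rewrite qx /x ?jn //; lia.
Qed.

(* Each word of A or B opened at a run of n - 1 equal symbols e absorbs n - 1
   symbols of the word e^N of [e], leaving e^(2R+2) in front of it. *)
Lemma lfsr_combines (R n : nat) (c : {poly 'F_2}) (a b : nat -> 'F_2) :
  size c = n.+1 -> c`_0 = 1 -> primitive_poly c -> (1 < n)%N ->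
  recurrence n c 0 a -> (exists2 i, (i < n)%N & a i != 0) ->
  recurrence n c 1 b -> (exists2 i, (i < n)%N & b i != 1) ->
  exists2 s, size s = (2 ^ n.+1 + 2 * n + 8 * R + 2)%N &
    combines (n + 2 * R + 1)
      [:: mkseq a (2 ^ n - 1); mkseq b (2 ^ n - 1); [:: 0]; [:: 1]] s.
Proof.
move=> sc c0 prim n1 ra a0 rb b0.
have v0 := primitive_period_gt0 sc prim.
have pera k := recurrence_period sc c0 prim n1 k ra.
have perb k := recurrence_period sc c0 prim n1 k rb.
have vE : (2 ^ n.+1 = 2 * (2 ^ n - 1) + 2)%N.
  by rewrite expnS; have := v0; lia.
have [qa qav qa0] := recurrence_run sc c0 prim n1 ra a0.
have [qb qbv qb1] := recurrence_run sc c0 prim n1 rb b0.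
rewrite vE; move: v0 pera perb qav qbv; set v := (2 ^ n - 1)%N.
move=> v0 pera perb qav qbv.
set N := (n + 2 * R + 1)%N.
have N0 : (0 < N)%N by rewrite /N addn1.
pose word (t : seq 'F_2) q := cyclic_factor t q (size t + N - 1).
have word_size t q : size (word t q) = (size t + N - 1)%N by rewrite size_mkseq.
have wordE f q e : (forall k, f (v + k)%N = f k) ->
    (forall j, (j < n.-1)%N -> f (q + j)%N = e) -> exists u,
    nseq (2 * R + 2) e ++ word (mkseq f v) q = word [:: e] 0%N ++ u.
  move=> perf fe; rewrite /word cyclic_factor_mkseq // cyclic_factor1 size_mkseq.
  (* The initial run has n - 1 symbols, and (2R + 2) + (n - 1) = N is the length of the word of
     [[:: e]]. *)
  have -> : (v + N - 1 = n.-1 + (v + 2 * R + 1))%N by rewrite /N; lia.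
  rewrite (mkseq_nseq_cat _ fe) catA -nseqD.
  eexists; congr (nseq _ _ ++ _); rewrite /= /N; lia.
have [ua uaE] := wordE a qa 0 pera qa0.
have [ub ubE] := wordE b qb 1 perb qb1.
pose Z : seq 'F_2 := nseq (2 * R + 2) 0.
pose O : seq 'F_2 := nseq (2 * R + 2) 1.
pose wa := word (mkseq a v) qa; pose wb := word (mkseq b v) qb.
rewrite -/Z -/wa in uaE; rewrite -/O -/wb in ubE.
have sZ : size Z = (2 * R + 2)%N by rewrite size_nseq.
have sO : size O = (2 * R + 2)%N by rewrite size_nseq.
have swa : size wa = (v + N - 1)%N by rewrite word_size size_mkseq.
have swb : size wb = (v + N - 1)%N by rewrite word_size size_mkseq.
(* With v = 2^n - 1 the length is 2(2R + 2) + 2(v + n + 2R) = 2^(n+1) + 2n + 8R + 2. *)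
exists (Z ++ wa ++ O ++ wb).
  by rewrite !size_cat sZ sO swa swb /N; lia.
(* The words of [0] and [1] start with [Z] and [O] and run on into [wa] and [wb]. *)
exists (nth 0%N [:: size Z; size (Z ++ wa ++ O); 0%N; size (Z ++ wa)]); split.
  case=> [|[|[|[|//]]]] _.
  - by apply: (opened_at_cat (s1 := Z) (s2 := wa) (s3 := O ++ wb) (q := qa)) => //;
      rewrite size_mkseq.
  - apply: (opened_at_cat (s1 := Z ++ wa ++ O) (s2 := wb) (s3 := [::]) (q := qb)) => //.
      by rewrite cats0 -!catA.
    by rewrite size_mkseq.
  - apply: (opened_at_cat (s1 := [::]) (s2 := word [:: 0] 0%N)
             (s3 := ua ++ O ++ wb) (q := 0%N)) => //.
    by rewrite catA uaE -catA.
  - apply: (opened_at_cat (s1 := Z ++ wa) (s2 := word [:: 1] 0%N)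
             (s3 := ub) (q := 0%N)) => //.
    by rewrite -ubE catA.
move=> i; set sz := size (Z ++ _) => isz.
have szE : sz = (2 * (2 * R + 2) + 2 * (v + N - 1))%N.
  by rewrite /sz !size_cat sZ sO swa swb; lia.
pose p := nth 0%N [:: size Z; size (Z ++ wa ++ O); 0%N; size (Z ++ wa)].
pose ts : seq (seq 'F_2) := [:: mkseq a v; mkseq b v; [:: 0]; [:: 1]].
(* No occurrence has to wrap around: the four blocks are covered in turn by the words of [0], A, [1]
   and B. *)
suff [l [l4 pi id]] : exists l, [/\ (l < 4)%N, (p l <= i)%N &
    (i < p l + (size (nth [::] ts l) + N - 1))%N].
  exists l, (i - p l)%N; split=> //; last by rewrite subnKC ?modn_small.
  by rewrite ltn_subLR // -/ts.
have := isz; rewrite szE /p => {}isz.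
have [iZ|Zi] := ltnP i (2 * R + 2).
  by exists 2%N; split => //=; rewrite /N; lia.
have [ia|ai] := ltnP i (2 * R + 2 + (v + N - 1)).
  by exists 0%N; split => //=; rewrite ?size_mkseq sZ; lia.
have [iO|Oi] := ltnP i (2 * (2 * R + 2) + (v + N - 1)).
  by exists 3%N; split => //=; rewrite !size_cat sZ swa // /N; lia.
by exists 1%N; split => //=; rewrite !size_cat sZ swa sO ?size_mkseq; lia.
Qed.

(** * The covering property *)

(** This holds for every gluing, whatever its length. The extension of the first [n] symbols of [x]
    that lies within distance [R] is a window of [[:: e]] if constantly [e], and otherwise of A or
    B, whose windows exhaust the remaining n-tuples. *)
Lemma combines_covering (R n : nat) (c : {poly 'F_2}) (a b : nat -> 'F_2) s :
  size c = n.+1 -> c`_0 = 1 -> primitive_poly c -> (1 < n)%N ->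
  (forall i, (1 <= i <= 2 * R + 1)%N -> c`_i = 0) ->
  recurrence n c 0 a -> (exists2 i, (i < n)%N & a i != 0) ->
  recurrence n c 1 b -> (exists2 i, (i < n)%N & b i != 1) ->
  combines (n + 2 * R + 1)
    [:: mkseq a (2 ^ n - 1); mkseq b (2 ^ n - 1); [:: 0]; [:: 1]] s ->
  covering_sequence (n + 2 * R + 1) R s.
Proof.
move=> sc c0 prim n1 gap ra a0 rb b0 comb x.
have v0 := primitive_period_gt0 sc prim.
have /fin_all_exists2[w rw wx] : forall e : 'F_2, exists2 w : nat -> 'F_2,
    recurrence n c e w & forall j, (j < n)%N -> w j = x`_j.
  by move=> e; apply: recurrence_exists.
have [e he] := hamming_complementary gap rw wx.
suff [i is_ iw] : exists2 i, (i < size s)%N &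
    cyclic_factor s i (n + 2 * R + 1) = mkseq (w e) (n + 2 * R + 1).
  by exists i; rewrite // iw.
have const_window l : (l < 4)%N -> nth [::] [:: mkseq a (2 ^ n - 1);
      mkseq b (2 ^ n - 1); [:: 0]; [:: 1]] l = [:: e] -> w e =1 (fun=> e) ->
    exists2 i, (i < size s)%N &
      cyclic_factor s i (n + 2 * R + 1) = mkseq (w e) (n + 2 * R + 1).
  move=> l4 le we; have [|i is_ iE] := combines_window (k := 0) comb l4.
    by rewrite le.
  exists i => //; rewrite iE le cyclic_factor1.
  apply: (@eq_from_nth _ 0); rewrite size_nseq ?size_mkseq // => j jN.
  by rewrite nth_nseq jN nth_mkseq // we.
have lfsr_window l f : (l < 4)%N -> nth [::] [:: mkseq a (2 ^ n - 1);
      mkseq b (2 ^ n - 1); [:: 0]; [:: 1]] l = mkseq f (2 ^ n - 1) ->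
    recurrence n c e f -> (exists2 i, (i < n)%N & f i != e) ->
    (exists2 i, (i < n)%N & w e i != e) ->
    exists2 i, (i < size s)%N &
      cyclic_factor s i (n + 2 * R + 1) = mkseq (w e) (n + 2 * R + 1).
  move=> l4 le rf f0 w0.
  have [k kv kw] := recurrence_window_onto sc c0 prim n1 rf f0 w0.
  have [|i is_ iE] := combines_window (k := k) comb l4.
    by rewrite le size_mkseq.
  exists i => //; rewrite iE le cyclic_factor_mkseq //; last first.
    by move=> j; apply: (recurrence_period sc c0 prim n1 j rf).
  apply: eq_mkseq => j.
  exact: (recurrence_inj (recurrence_shift k rf) (rw e) kw).
have [/existsP[i wi]|/existsPn w0] := boolP [exists i : 'I_n, w e i != e].
  have w0 : exists2 i, (i < n)%N & w e i != e by exists i.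
  case: (eqVneq e 0) w0 => [e0|/F2_neq0 e1] w0.
    by apply: (lfsr_window 0%N a); rewrite ?e0 // -e0.
  by apply: (lfsr_window 1%N b); rewrite ?e1 // -e1.
have we : w e =1 (fun=> e).
  apply: (recurrence_inj (rw e) (recurrence_const sc c0 prim n1 e)).
  by move=> j jn; have /= := w0 (Ordinal jn); rewrite negbK => /eqP.
have [e0|/F2_neq0 e1] := eqVneq e 0.
  by apply: (const_window 2%N); rewrite // e0.
by apply: (const_window 3%N); rewrite // e1.
Qed.

Theorem theorem5 (R n : nat) (c : {poly 'F_2})
    (hsize : size c = n.+1) (hprim : primitive_poly c)
    (hc0 : c`_0 = 1) (hcn : c`_n = 1)
    (hgap : forall i : nat, (1 <= i <= 2 * R + 1)%N -> c`_i = 0) :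
  (forall a b : nat -> 'F_2,
     recurrence n c 0 a -> (exists2 i : nat, (i < n)%N & a i != 0) ->
     recurrence n c 1 b -> (exists2 i : nat, (i < n)%N & b i != 1) ->
     exists s : seq 'F_2,
       [/\ size s = (2 ^ n.+1 + 2 * n + 8 * R + 2)%N,
           combines (n + 2 * R + 1)
             [:: mkseq a (2 ^ n - 1); mkseq b (2 ^ n - 1); [:: 0]; [:: 1]] s &
           covering_sequence (n + 2 * R + 1) R s]) /\
  (exists s : seq 'F_2,
     size s = (2 ^ n.+1 + 2 * n + 8 * R + 2)%N /\
     covering_sequence (n + 2 * R + 1) R s).
Proof.
(* Degree 0 is not irreducible, and degree 1 would give c_1 = c_n = 1 against the gap. *)
have n1 : (1 < n)%N.
  rewrite ltnNge; apply/negP => n1; move: hcn hsize hgap.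
  case: n n1 => [|[|//]] _ cn sc gap.
    by have [] := primitive_irreducible hprim; rewrite sc.
  by move: cn; rewrite gap //; lia.
suff main a b : recurrence n c 0 a -> (exists2 i : nat, (i < n)%N & a i != 0) ->
    recurrence n c 1 b -> (exists2 i : nat, (i < n)%N & b i != 1) ->
    exists s : seq 'F_2,
    [/\ size s = (2 ^ n.+1 + 2 * n + 8 * R + 2)%N,
        combines (n + 2 * R + 1)
          [:: mkseq a (2 ^ n - 1); mkseq b (2 ^ n - 1); [:: 0]; [:: 1]] s &
        covering_sequence (n + 2 * R + 1) R s].
  split=> //.
  (* All-ones is an admissible initial tuple for A, and all-zeros for B. *)
  have [a ra ax] := recurrence_exists n c 0 (fun=> 1).
  have [b rb bx] := recurrence_exists n c 1 (fun=> 0).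
  have [||s [ss _ cs]] := main a b ra _ rb; last by exists s.
  - by exists 0%N; rewrite ?ax //; lia.
  - by exists 0%N; rewrite ?bx //; lia.
move=> ra a0 rb b0.
have [s ss sc] := lfsr_combines R hsize hc0 hprim n1 ra a0 rb b0.
exists s; split=> //.
exact: (combines_covering hsize hc0 hprim n1 hgap ra a0 rb b0 sc).
Qed.
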